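(* Let $W_\Gamma$ be the Coxeter group associated to a Coxeter graph $\Gamma$ and let $\Gamma_1,\ldots,\Gamma_n$ be the connected components of $\Gamma$. If $n\geq 2$, then for all $i,j\in\{1,\ldots,n\}$ with $i\neq j$ the automorphism group $\mathrm{Aut}(W_\Gamma)$ virtually surjects onto the free product $W_{\Gamma_i}^{ab}*W_{\Gamma_j}^{ab}\cong(\mathbb{Z}/2\mathbb{Z})^k*(\mathbb{Z}/2\mathbb{Z})^l$ where $k,l\geq 1$; that is, there exist a finite index subgroup $H\subseteq\mathrm{Aut}(W_\Gamma)$ and a surjective group homomorphism $H\twoheadrightarrow W_{\Gamma_i}^{ab}*W_{\Gamma_j}^{ab}$, where $W_{\Gamma_i}^{ab}\cong(\mathbb{Z}/2\mathbb{Z})^k$ and $W_{\Gamma_j}^{ab}\cong(\mathbb{Z}/2\mathbb{Z})^l$ for some $k,l\geq 1$.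
   Context: A Coxeter graph is a finite simplicial graph $\Gamma$ with vertex set $V(\Gamma)$, edge set $E(\Gamma)$ (a set of two-element subsets of $V(\Gamma)$) and an edge-labeling $\varphi\colon E(\Gamma)\to\{2,3,4,\ldots\}$. The associated Coxeter group is $$W_\Gamma=\langle V(\Gamma)\mid v^2 \text{ for all } v\in V(\Gamma),\ (vw)^{\varphi(\{v,w\})}\text{ for all }\{v,w\}\in E(\Gamma)\rangle$$ (there is no relation between $v$ and $w$ when they are not adjacent). $W_{\Gamma_i}$ is the Coxeter group of the connected component $\Gamma_i$ with the restricted labeling, and $G^{ab}$ denotes the abelianization of a group $G$. *)

(* Defs.v *)
From HB Require Import structures.
From mathcomp Require Import all_boot zmodp.
From mathcomp Require Import boolp classical_sets cardinality.

Set Implicit Arguments.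
Unset Strict Implicit.
Unset Printing Implicit Defensive.

Local Open Scope quotient_scope.
Local Open Scope group_scope.

(* A congruence on a star monoid M with x^-1 * x ~ 1 for all x; the quotient
   of M by it is a group. It is used with M a group, and with M the words in
   letters and formal inverses of letters. *)
Record group_congruence (M : starMonoidType) := GroupCongruence {
  cong_rel :> M -> M -> Prop;
  cong_refl : forall x, cong_rel x x;
  cong_sym : forall x y, cong_rel x y -> cong_rel y x;
  cong_trans : forall x y z, cong_rel x y -> cong_rel y z -> cong_rel x z;
  congM : forall x x' y y',
    cong_rel x x' -> cong_rel y y' -> cong_rel (x * y) (x' * y');
  congV : forall x y, cong_rel x y -> cong_rel x^-1 y^-1;
  cong_mulVg : forall x, cong_rel (x^-1 * x) 1
}.

Section QuotientGroup.
Variables (M : starMonoidType) (c : group_congruence M).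

Definition cong_bool : rel M := fun x y => `[< c x y >].

Fact cong_bool_refl : reflexive cong_bool.
Proof. by move=> x; apply/asboolP/cong_refl. Qed.

Fact cong_bool_sym : symmetric cong_bool.
Proof. by move=> x y; apply/asboolP/asboolP; apply: cong_sym. Qed.

Fact cong_bool_trans : transitive cong_bool.
Proof. by move=> y x z /asboolP xy /asboolP yz; apply/asboolP/(cong_trans xy). Qed.

Canonical cong_equiv := EquivRel cong_bool
  cong_bool_refl cong_bool_sym cong_bool_trans.

Definition quot_group := {eq_quot cong_equiv}.
HB.instance Definition _ := EqQuotient.on quot_group.
HB.instance Definition _ := Choice.on quot_group.

Lemma quot_groupP x y : \pi_quot_group x = \pi_quot_group y <-> c x y.
Proof. by split=> [/eqmodP/asboolP//|xy]; apply/eqmodP/asboolP. Qed.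

Lemma quot_group_repr x : c (repr (\pi_quot_group x)) x.
Proof. by apply/quot_groupP; rewrite reprK. Qed.

Let mulq (x y : quot_group) := \pi_quot_group (repr x * repr y).
Let invq (x : quot_group) := \pi_quot_group (repr x)^-1.

Let pi_mulq x y : mulq (\pi x) (\pi y) = \pi_quot_group (x * y).
Proof. by apply/quot_groupP/congM; apply: quot_group_repr. Qed.

Let pi_invq x : invq (\pi x) = \pi_quot_group x^-1.
Proof. by apply/quot_groupP/congV/quot_group_repr. Qed.

Fact quot_mulgA : associative mulq.
Proof.
by elim/quotW=> x; elim/quotW=> y; elim/quotW=> z; rewrite !pi_mulq mulgA.
Qed.

Fact quot_mul1g : left_id (\pi_quot_group 1) mulq.
Proof. by elim/quotW=> x; rewrite pi_mulq mul1g. Qed.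

Fact quot_mulg1 : right_id (\pi_quot_group 1) mulq.
Proof. by elim/quotW=> x; rewrite pi_mulq mulg1. Qed.

Fact quot_mulVg : left_inverse (\pi_quot_group 1) invq mulq.
Proof.
by elim/quotW=> x; rewrite pi_invq pi_mulq; apply/quot_groupP/cong_mulVg.
Qed.

Fact quot_mulgV : right_inverse (\pi_quot_group 1) invq mulq.
Proof.
elim/quotW=> x; rewrite pi_invq pi_mulq; apply/quot_groupP.
by rewrite -{1}[x]invgK; apply: cong_mulVg.
Qed.

HB.instance Definition _ := isGroup.Build quot_group
  quot_mulgA quot_mul1g quot_mulg1 quot_mulVg quot_mulgV.

Lemma quot_groupM x y : 
  \pi_quot_group (x * y) = \pi_quot_group x * \pi_quot_group y :> quot_group.
Proof. by rewrite -pi_mulq. Qed.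

Lemma quot_groupV x : \pi_quot_group x^-1 = (\pi_quot_group x)^-1 :> quot_group.
Proof. by rewrite -pi_invq. Qed.

Lemma quot_group1 : \pi_quot_group 1 = 1 :> quot_group.
Proof. by []. Qed.

End QuotientGroup.

(* The letter (x, false) stands for x and (x, true) for its formal inverse. *)
Definition word (X : choiceType) := seq (X * bool).

Section Words.
Variable X : choiceType.

HB.instance Definition _ := Choice.on (word X).

Definition word_inv (u : word X) : word X := rev [seq (a.1, ~~ a.2) | a <- u].

Fact word_invK : involutive word_inv.
Proof.
move=> u; rewrite /word_inv map_rev revK -map_comp map_id_in //.
by move=> [x b] _ /=; rewrite negbK.
Qed.

Fact word_invM : {morph word_inv : u v / u ++ v >-> v ++ u}.
Proof. by move=> u v; rewrite /word_inv map_cat rev_cat. Qed.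

HB.instance Definition _ := isStarMonoid.Build (word X)
  (@catA (X * bool)) (@cat0s (X * bool)) word_invK word_invM.

Definition letter (x : X) : word X := [:: (x, false)].

Inductive pres_rel (R : word X -> Prop) : word X -> word X -> Prop :=
| PresRefl u : pres_rel R u u
| PresSym u v : pres_rel R u v -> pres_rel R v u
| PresTrans u v w : pres_rel R u v -> pres_rel R v w -> pres_rel R u w
| PresMul u u' v v' :
    pres_rel R u u' -> pres_rel R v v' -> pres_rel R (u * v) (u' * v')
| PresInv u v : pres_rel R u v -> pres_rel R u^-1 v^-1
| PresMulVg u : pres_rel R (u^-1 * u) 1
| PresRelator r : R r -> pres_rel R r 1.

Definition pres_congruence (R : word X -> Prop) : group_congruence (word X) :=
  GroupCongruence (@PresRefl R) (@PresSym R) (@PresTrans R) (@PresMul R)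
    (@PresInv R) (@PresMulVg R).

(* < X | R > *)
Definition presented_group (R : word X -> Prop) : groupType :=
  quot_group (pres_congruence R).

End Words.

Section Abelianization.
Variable G : groupType.

Inductive generated (A : G -> Prop) : G -> Prop :=
| GenIn x : A x -> generated A x
| Gen1 : generated A 1
| GenM x y : generated A x -> generated A y -> generated A (x * y)
| GenV x : generated A x -> generated A x^-1.

Definition derived_subgroup : G -> Prop :=
  generated (fun z => exists x y : G, z = [~ x, y]).

Lemma derived_subgroupJ x y : derived_subgroup x -> derived_subgroup (x ^ y).
Proof.
elim=> [_ [a [b ->]]||a b _ IHa _ IHb|a _ IHa].
- by apply: GenIn; exists (a ^ y), (b ^ y); rewrite conjRg.
- by rewrite conj1g; apply: Gen1.
- by rewrite conjMg; apply: GenM.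
- by rewrite conjVg; apply: GenV.
Qed.

Definition derived_rel (x y : G) : Prop := derived_subgroup (x^-1 * y).

Fact derived_refl x : derived_rel x x.
Proof. by rewrite /derived_rel mulVg; apply: Gen1. Qed.

Fact derived_sym x y : derived_rel x y -> derived_rel y x.
Proof. by move=> /GenV; rewrite invgM invgK. Qed.

Fact derived_trans x y z : derived_rel x y -> derived_rel y z -> derived_rel x z.
Proof. by move=> xy /(GenM xy); rewrite -mulgA mulVKg. Qed.

Fact derivedM x x' y y' :
  derived_rel x x' -> derived_rel y y' -> derived_rel (x * y) (x' * y').
Proof.
move=> /(derived_subgroupJ y) xx' /(GenM xx').
by rewrite /derived_rel /conjg invgM -!mulgA mulVKg.
Qed.

Fact derivedV x y : derived_rel x y -> derived_rel x^-1 y^-1.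
Proof.
move=> /derived_sym/(derived_subgroupJ y^-1).
by rewrite /derived_rel /conjg !invgK !mulgA mulgV mul1g.
Qed.

Fact derived_mulVg x : derived_rel (x^-1 * x) 1.
Proof. by rewrite mulVg; apply: derived_refl. Qed.

Definition derived_congruence : group_congruence G :=
  GroupCongruence derived_refl derived_sym derived_trans derivedM derivedV
    derived_mulVg.

(* G / [G, G] *)
Definition abelianization : groupType := quot_group derived_congruence.

End Abelianization.

(* The free product is presented by all elements of both factors, subject to
   the two multiplication tables. *)
Variant free_product_relators (G H : groupType) : word (G + H)%type -> Prop :=
| FreeProdL (a b : G) : free_product_relators
    (letter (inl a) * letter (inl b) * (letter (inl (a * b)))^-1)
| FreeProdR (a b : H) : free_product_relators
    (letter (inr a) * letter (inr b) * (letter (inr (a * b)))^-1).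

Definition free_product (G H : groupType) : groupType :=
  presented_group (@free_product_relators G H).

Section AutomorphismGroup.
Variable G : groupType.

Definition is_automorphism (f : G -> G) : Prop :=
  {morph f : x y / x * y} /\ bijective f.

Record automorphism := Automorphism {
  aut_fun :> G -> G;
  aut_funP : is_automorphism aut_fun
}.

HB.instance Definition _ := gen_eqMixin automorphism.
HB.instance Definition _ := gen_choiceMixin automorphism.

Lemma automorphismP (f g : automorphism) : f =1 g -> f = g.
Proof.
case: f g => [f fP] [g gP] /= /funext fg; case: _ / fg gP => gP.
by rewrite (Prop_irrelevance fP gP).
Qed.

Fact aut_one_subproof : is_automorphism idfun.
Proof. by split=> //; exists idfun. Qed.
Definition aut_one := Automorphism aut_one_subproof.

Fact aut_mul_subproof (f g : automorphism) : is_automorphism (f \o g).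
Proof.
split; last exact: bij_comp (aut_funP f).2 (aut_funP g).2.
by move=> x y /=; rewrite (aut_funP g).1 (aut_funP f).1.
Qed.
Definition aut_mul f g := Automorphism (aut_mul_subproof f g).

Fact aut_inv_exists (f : automorphism) :
  exists g : automorphism, cancel f g /\ cancel g f.
Proof.
have [fM [g fK gK]] := aut_funP f.
have gP : is_automorphism g.
  by split; [move=> x y; apply: (canLR fK); rewrite fM !gK | exists f].
by exists (Automorphism gP).
Qed.
Definition aut_inv (f : automorphism) := projT1 (cid (aut_inv_exists f)).

Lemma aut_invK (f : automorphism) : cancel f (aut_inv f) /\ cancel (aut_inv f) f.
Proof. exact: projT2 (cid (aut_inv_exists f)). Qed.

Fact aut_mulgA : associative aut_mul.
Proof. by move=> f g h; apply: automorphismP. Qed.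

Fact aut_mul1g : left_id aut_one aut_mul.
Proof. by move=> f; apply: automorphismP. Qed.

Fact aut_mulg1 : right_id aut_one aut_mul.
Proof. by move=> f; apply: automorphismP. Qed.

Fact aut_mulVg : left_inverse aut_one aut_inv aut_mul.
Proof. by move=> f; apply: automorphismP; apply: (aut_invK f).1. Qed.

Fact aut_mulgV : right_inverse aut_one aut_inv aut_mul.
Proof. by move=> f; apply: automorphismP; apply: (aut_invK f).2. Qed.

HB.instance Definition _ := isGroup.Build automorphism
  aut_mulgA aut_mul1g aut_mulg1 aut_mulVg aut_mulgV.

End AutomorphismGroup.

Section Subgroups.
Variables (G : groupType) (H : groupClosed G).

Record subgroup := Subgroup { subgroup_val : G; _ : subgroup_val \in H }.

HB.instance Definition _ := [isSub for subgroup_val].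
HB.instance Definition _ := [Choice of subgroup by <:].

Fact subgroup_closed : group_closed (mem H).
Proof. by split; [apply: gpred1 | apply: gpredF]. Qed.

HB.instance Definition _ :=
  SubChoice_isSubGroup.Build G (mem H) subgroup subgroup_closed.

Definition left_coset (x : G) : set G := [set y | x^-1 * y \in H]%classic.

Definition finite_index : Prop := finite_set (range left_coset).

End Subgroups.

Definition virtually_surjects (G K : groupType) : Prop :=
  exists (H : groupClosed G) (f : {multiplicative subgroup H -> K}),
    finite_index H /\ forall y : K, exists x, f x = y.

Definition isomorphic (G H : groupType) : Prop :=
  exists f : {multiplicative G -> H}, bijective f.

(* (Z/2Z)^k; the group law of 'Z_2 is its addition. *)
Definition Z2_power (k : nat) : groupType := {ffun 'I_k -> 'Z_2}.

(* The values of [label] outside [edge] are irrelevant. *)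
Record coxeter_graph := CoxeterGraph {
  vertex : finType;
  edge : {set {set vertex}};
  label : {set vertex} -> nat;
  card_edge : {in edge, forall e : {set vertex}, #|e| = 2};
  label_ge2 : {in edge, forall e : {set vertex}, 2 <= label e}
}.

Section CoxeterGraphs.
Variable Gamma : coxeter_graph.

Definition adjacent : rel (vertex Gamma) :=
  fun v w => [set v; w] \in edge Gamma.

Definition components : {set {set vertex Gamma}} :=
  equivalence_partition (connect adjacent) [set: vertex Gamma].

Section Induced.
Variable C : {set vertex Gamma}.
Let V := {v : vertex Gamma | v \in C}.

Definition induced_edge : {set {set V}} :=
  [set e : {set V} | val @: e \in edge Gamma].

Definition induced_label (e : {set V}) : nat := label (val @: e).

Fact induced_card_edge : {in induced_edge, forall e : {set V}, #|e| = 2}.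
Proof.
by move=> e; rewrite inE => /card_edge; rewrite card_imset //; apply: val_inj.
Qed.

Fact induced_label_ge2 :
  {in induced_edge, forall e : {set V}, 2 <= induced_label e}.
Proof. by move=> e; rewrite inE => /label_ge2. Qed.

Definition induced : coxeter_graph :=
  CoxeterGraph induced_card_edge induced_label_ge2.

End Induced.

Variant coxeter_relators : word (vertex Gamma) -> Prop :=
| CoxeterVertex v : coxeter_relators (letter v ^+ 2)
| CoxeterEdge v w : [set v; w] \in edge Gamma ->
    coxeter_relators ((letter v * letter w) ^+ label [set v; w]).

Definition coxeter_group : groupType := presented_group coxeter_relators.

End CoxeterGraphs.

(* Main.v *)
Require Import Defs.
From HB Require Import structures.
From mathcomp Require Import all_boot zmodp.
From mathcomp Require Import boolp classical_sets cardinality.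

(* The abelianized retractions of W onto its component groups combine into
   q : W -> P = A * B, with A and B the abelianized groups of C and D. Those
   automorphisms f of W for which q \o f is a P-conjugate of q form a subgroup,
   which maps to P because P is centerless, and onto P because it contains the
   inner automorphisms.

   Its index is finite because, up to conjugation, q \o f takes only finitely
   many values. A nontrivial involution of a free product of two elementary
   abelian 2-groups lies in a unique conjugate of a factor, and two involutions
   whose product has finite order lie in the same conjugate. Hence f sends each
   component into one factor, and, by counting, permutes the components. So
   q \o f maps one component into a conjugate of A, another one into a conjugate
   of B, and the others to 1. Being surjective, it forces, after an overall
   conjugation, both conjugates to be the factors themselves, which leaves
   finitely many possibilities since A and B are finite. *)

Set Implicit Arguments.
Unset Strict Implicit.
Unset Printing Implicit Defensive.

Local Open Scope quotient_scope.
Local Open Scope group_scope.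

(** * Presentations and abelianizations *)

(* [gmulf1] and its consequences need a [UMagmaMorphism] structure, which
   [{multiplicative G -> H}] does not provide, even between groups. *)
Section GroupHom.
Variables (G H : groupType) (f : {multiplicative G -> H}).

Lemma hom1 : f 1 = 1.
Proof. by apply: (@mulgI _ (f 1)); rewrite -gmulfM !mulg1. Qed.

Lemma homV : {morph f : x / x^-1}.
Proof. by move=> x; apply/esym/mulg1_eq; rewrite -gmulfM mulgV hom1. Qed.

Lemma homX n : {morph f : x / x ^+ n}.
Proof. by move=> x; elim: n => [|n IHn]; rewrite ?hom1 // !expgS gmulfM IHn. Qed.

Lemma homJ : {morph f : x y / x ^ y}.
Proof. by move=> x y; rewrite /conjg !gmulfM homV. Qed.

Lemma homR : {morph f : x y / [~ x, y]}.
Proof. by move=> x y; rewrite /commg gmulfM homJ homV. Qed.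

End GroupHom.

Section Presentation.
Variables (X : choiceType) (R : word X -> Prop).

Definition gen (x : X) : presented_group R :=
  \pi_(quot_group (pres_congruence R)) (letter x).

Definition word_eval (K : groupType) (h : X -> K) (u : word X) : K :=
  \prod_(a <- u) (if a.2 then (h a.1)^-1 else h a.1).

Lemma word_eval1 (K : groupType) (h : X -> K) : word_eval h 1 = 1.
Proof. exact: big_nil. Qed.

Lemma word_evalM (K : groupType) (h : X -> K) :
  {morph word_eval h : u v / u * v}.
Proof. by move=> u v; apply: big_cat. Qed.

Lemma word_evalX (K : groupType) (h : X -> K) n :
  {morph word_eval h : u / u ^+ n}.
Proof.
move=> u; elim: n => [|n IHn]; first exact: word_eval1.
by rewrite !expgS word_evalM IHn.
Qed.

Lemma word_eval_letter (K : groupType) (h : X -> K) x :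
  word_eval h (letter x) = h x.
Proof. by rewrite /word_eval big_seq1. Qed.

Lemma word_evalV (K : groupType) (h : X -> K) u :
  word_eval h u^-1 = (word_eval h u)^-1.
Proof.
rewrite /word_eval -[u in RHS]revK -prodgV -[u^-1]/(word_inv u) /word_inv.
rewrite -map_rev big_map; apply: eq_bigr => -[x []] _ //=.
by rewrite invgK.
Qed.

Lemma genE (u : word X) :
  \pi_(quot_group (pres_congruence R)) u = word_eval gen u.
Proof.
elim: u => [|[x b] u IHu]; first by rewrite /word_eval big_nil.
have -> : (x, b) :: u = ([:: (x, b)] : word X) * (u : word X) by [].
rewrite word_evalM quot_groupM IHu /word_eval big_seq1; congr (_ * _).
by case: b => //=; rewrite -quot_groupV.
Qed.

Lemma gen_relator r : R r -> word_eval gen r = 1.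
Proof. by move=> Rr; rewrite -genE; apply/quot_groupP/PresRelator. Qed.

Lemma presented_ind (Q : presented_group R -> Prop) :
  Q 1 -> (forall x y, Q x -> Q y -> Q (x * y)) ->
  (forall x, Q (gen x)) -> (forall x, Q (gen x)^-1) -> forall x, Q x.
Proof.
move=> Q1 QM Qgen QgenV; elim/quotW=> u; rewrite genE.
elim: u => [|[x b] u IHu]; first by rewrite word_eval1; apply: Q1.
rewrite /word_eval big_cons; apply: QM; last exact: IHu.
by case: b; [apply: QgenV | apply: Qgen].
Qed.

Lemma presented_ext (K : groupType) (f g : {multiplicative presented_group R -> K}) :
  (forall x, f (gen x) = g (gen x)) -> f =1 g.
Proof.
move=> fg x; elim/presented_ind: x => [|x y fgx fgy|//|x].
- by rewrite !hom1.
- by rewrite !gmulfM fgx fgy.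
- by rewrite !homV fg.
Qed.

Section Lift.
Variables (K : groupType) (h : X -> K).
Hypothesis hR : forall r, R r -> word_eval h r = 1.

Fact word_eval_pres_rel u v : pres_rel R u v -> word_eval h u = word_eval h v.
Proof.
elim=> {u v} [//|//|u v w _ -> _ -> //|u u' v v' _ IHu _ IHv|u v _ IHu|u|r Rr].
- by rewrite !word_evalM IHu IHv.
- by rewrite !word_evalV IHu.
- by rewrite word_evalM word_evalV mulVg word_eval1.
- by rewrite hR // word_eval1.
Qed.

(** Evaluates a chosen representative word; [presented_lift_pi] shows that the choice does not
    matter once [h] respects the relators. *)
Definition presented_lift (x : presented_group R) : K := word_eval h (repr x).

Fact presented_lift_pi u :
  presented_lift (\pi_(quot_group (pres_congruence R)) u) = word_eval h u.
Proof. exact/word_eval_pres_rel/(quot_group_repr (pres_congruence R)). Qed.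

Fact presented_liftM : {morph presented_lift : x y / x * y}.
Proof.
elim/quotW=> u; elim/quotW=> v.
by rewrite -quot_groupM !presented_lift_pi word_evalM.
Qed.

Lemma presented_lift_gen x : presented_lift (gen x) = h x.
Proof. by rewrite presented_lift_pi word_eval_letter. Qed.

End Lift.
End Presentation.

Section Abelianization.
Variable G : groupType.

Definition to_ab (x : G) : abelianization G :=
  \pi_(quot_group (derived_congruence G)) x.

Fact to_abM : {morph to_ab : x y / x * y}.
Proof. exact: quot_groupM. Qed.

HB.instance Definition _ := isMultiplicative.Build G (abelianization G)
  to_ab to_abM.

Lemma to_ab_surj (a : abelianization G) : exists x, to_ab x = a.
Proof. by exists (repr a); apply: reprK. Qed.

Lemma abelianization_comm (a b : abelianization G) : commute a b.
Proof.
have [[x <-] [y <-]] := (to_ab_surj a, to_ab_surj b).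
rewrite /commute -!gmulfM; apply/(quot_groupP (derived_congruence G)).
apply: GenIn; exists y, x.
by rewrite /commg /conjg invgM !mulgA.
Qed.

Section Lift.
Variables (K : groupType) (f : {multiplicative G -> K}).
Hypothesis Kcomm : forall a b : K, commute a b.

Definition ab_lift (a : abelianization G) : K := f (repr a).

Lemma ab_lift_to_ab x : ab_lift (to_ab x) = f x.
Proof.
have : derived_rel (repr (to_ab x)) x.
  exact: (quot_group_repr (derived_congruence G)).
(* Since [K] is commutative, [f] kills the derived subgroup, so its value does not depend on the
   representative. *)
have fD z : derived_subgroup z -> f z = 1.
  elim=> {z} [_ [a [b ->]]||a b _ IHa _ IHb|a _ IHa]; rewrite ?hom1 //.
  - by rewrite homR; apply/eqP/commgP/Kcomm.
  - by rewrite gmulfM IHa IHb mulg1.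
  - by rewrite homV IHa invg1.
by move=> /fD; rewrite gmulfM homV => /mulg1_eq; rewrite invgK.
Qed.

Fact ab_liftM : {morph ab_lift : a b / a * b}.
Proof.
move=> a b; have [[x <-] [y <-]] := (to_ab_surj a, to_ab_surj b).
by rewrite -gmulfM !ab_lift_to_ab gmulfM.
Qed.

HB.instance Definition _ := isMultiplicative.Build (abelianization G) K
  ab_lift ab_liftM.

End Lift.
End Abelianization.

(** * Normal forms in free products *)

Section FreeProduct.
Variables G H : groupType.
Implicit Types (x y : G + H) (s t : seq (G + H)).

Local Notation P := (free_product G H).

Definition syllable x : P := gen (@free_product_relators G H) x.
Definition inL (a : G) : P := syllable (inl a).
Definition inR (b : H) : P := syllable (inr b).

Fact inLM : {morph inL : a b / a * b}.
Proof.
move=> a b; apply/esym/divg1_eq; have := gen_relator (FreeProdL H a b).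
by rewrite !word_evalM word_evalV !word_eval_letter.
Qed.

Fact inRM : {morph inR : a b / a * b}.
Proof.
move=> a b; apply/esym/divg1_eq; have := gen_relator (FreeProdR G a b).
by rewrite !word_evalM word_evalV !word_eval_letter.
Qed.

HB.instance Definition _ := isMultiplicative.Build G P inL inLM.
HB.instance Definition _ := isMultiplicative.Build H P inR inRM.

Lemma free_product_ext (K : groupType) (f g : {multiplicative P -> K}) :
  (forall a, f (inL a) = g (inL a)) -> (forall b, f (inR b) = g (inR b)) ->
  f =1 g.
Proof. by move=> fgL fgR; apply: presented_ext => -[]. Qed.

Section Lift.
Variables (K : groupType).
Variables (f : {multiplicative G -> K}) (g : {multiplicative H -> K}).

Definition free_lift : P -> K :=
  presented_lift (fun x => match x with inl a => f a | inr b => g b end).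

Fact free_liftP r : free_product_relators r ->
  word_eval (fun x => match x with inl a => f a | inr b => g b end) r = 1.
Proof.
by case=> a b; rewrite !word_evalM word_evalV !word_eval_letter gmulfM mulgV.
Qed.

HB.instance Definition _ := isMultiplicative.Build P K
  free_lift (presented_liftM free_liftP).

Lemma free_lift_inL a : free_lift (inL a) = f a.
Proof. exact: (presented_lift_gen free_liftP). Qed.

Lemma free_lift_inR b : free_lift (inR b) = g b.
Proof. exact: (presented_lift_gen free_liftP). Qed.

End Lift.

Definition side x : bool := if x is inl _ then true else false.

Definition trivial_syllable x : bool :=
  match x with inl a => a == 1 | inr b => b == 1 end.

(* Only meaningful when both syllables are on the same side. *)
Definition syllable_mul x y : G + H :=
  match x, y with
  | inl a, inl b => inl (a * b)
  | inr a, inr b => inr (a * b)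
  | _, _ => x
  end.

Definition syllable_inv x : G + H :=
  match x with inl a => inl a^-1 | inr b => inr b^-1 end.

Definition reduced s : bool :=
  all (predC trivial_syllable) s && sorted (fun x y => side x != side y) s.

Definition eval s : P := \prod_(x <- s) syllable x.

Lemma eval_cons x s : eval (x :: s) = syllable x * eval s.
Proof. exact: big_cons. Qed.

Lemma eval_cat s t : eval (s ++ t) = eval s * eval t.
Proof. exact: big_cat. Qed.

Lemma eval_rcons s x : eval (rcons s x) = eval s * syllable x.
Proof. by rewrite -cats1 eval_cat /eval big_seq1. Qed.

Lemma syllableM x y :
  side x = side y -> syllable (syllable_mul x y) = syllable x * syllable y.
Proof. by case: x y => [a|b] [a'|b'] // _; [apply: inLM | apply: inRM]. Qed.

Lemma syllable_trivial x : trivial_syllable x -> syllable x = 1.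
Proof. by case: x => [a|b] /eqP->; [apply: (hom1 inL) | apply: (hom1 inR)]. Qed.

Lemma syllableV x : syllable (syllable_inv x) = (syllable x)^-1.
Proof. by case: x => [a|b]; [apply: (homV inL) | apply: (homV inR)]. Qed.

Definition ncons x s := if trivial_syllable x then s else x :: s.

(* Van der Waerden's trick: the free product acts on its reduced words, by left
   multiplication. *)
Definition act x s :=
  if s is y :: s' then
    if side x == side y then ncons (syllable_mul x y) s' else ncons x s
  else ncons x [::].

Lemma eval_ncons x s : eval (ncons x s) = syllable x * eval s.
Proof.
rewrite /ncons; case: ifP => [/syllable_trivial->|_]; last exact: eval_cons.
by rewrite mul1g.
Qed.

Lemma eval_act x s : eval (act x s) = syllable x * eval s.
Proof.
case: s => [|y s] /=; first exact: eval_ncons.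
case: eqP => [xy|_]; rewrite eval_ncons ?eval_cons //.
by rewrite syllableM // mulgA.
Qed.

Lemma reduced_cons x s : reduced (x :: s) =
  [&& ~~ trivial_syllable x, reduced s & if s is y :: _ then side x != side y else true].
Proof.
rewrite /reduced /=; case: s => [|y s] /=; first by rewrite !andbT.
by case: (~~ trivial_syllable x); case: (~~ trivial_syllable y);
  case: (all _ _); case: (side x != _); case: (path _ _ _).
Qed.

Lemma reduced_ncons x s : reduced s ->
  (if s is y :: _ then side x != side y else true) -> reduced (ncons x s).
Proof. by rewrite /ncons; case: ifPn => // xN sR xs; rewrite reduced_cons xN sR. Qed.

Lemma side_mul x y : side x = side y -> side (syllable_mul x y) = side y.
Proof. by case: x y => [a|b] [a'|b']. Qed.

Lemma reduced_act x s : reduced s -> reduced (act x s).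
Proof.
case: s => [|y s] sR /=; first exact: reduced_ncons.
case: eqP => [xy|/eqP xy]; last exact: reduced_ncons.
move: sR; rewrite reduced_cons => /and3P[_ sR ys].
by apply: reduced_ncons => //; rewrite side_mul.
Qed.

Lemma act_trivial x s : reduced s -> trivial_syllable x -> act x s = s.
Proof.
case: s => [|y s] sR xT; rewrite /act /ncons ?xT //; case: eqP => // xy.
suff -> : syllable_mul x y = y by move: sR; rewrite reduced_cons => /andP[/negPf->].
by case: x y xT xy {sR} => [a|b] [a'|b'] //= /eqP-> _; rewrite mul1g.
Qed.

Lemma syllable_mul_trivialr x y :
  side x = side y -> trivial_syllable y -> syllable_mul x y = x.
Proof. by case: x y => [a|b] [a'|b'] //= _ /eqP->; rewrite mulg1. Qed.

Lemma syllable_mulA x y z : side x = side y -> side y = side z ->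
  syllable_mul (syllable_mul x y) z = syllable_mul x (syllable_mul y z).
Proof. by case: x y z => [a|b] [a'|b'] [a''|b''] //=; rewrite mulgA. Qed.

(** The delicate case is that of [y] cancelling the head of [s]: the syllable thus exposed lies on
    the other side, so [x] is merely put in front of it. *)
Lemma act_act x y s : reduced s -> side x = side y ->
  act x (act y s) = act (syllable_mul x y) s.
Proof.
move=> sR xy; have xyS := side_mul xy.
have act_ncons z t : reduced t -> side z = side y ->
    (if t is y' :: _ then side y != side y' else true) ->
    act x (ncons z t) = ncons (syllable_mul x z) t.
  move=> tR zy tS; rewrite {1}/ncons; case: ifPn => [zT|_] /=; last first.
    by rewrite xy zy eqxx.
  rewrite syllable_mul_trivialr ?xy ?zy //.
  by case: t tS {tR} => //= y' t; rewrite xy => /negPf->.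
case: s sR => [|z s] sR /=; first by rewrite act_ncons.
rewrite xyS; case: eqP => [yz|/eqP yz]; last by rewrite act_ncons.
move: sR; rewrite reduced_cons => /and3P[_ sR zs].
by rewrite act_ncons ?side_mul ?syllable_mulA // yz.
Qed.

Definition word_act (u : word (G + H)%type) s :=
  foldr (fun a t => act (if a.2 then syllable_inv a.1 else a.1) t) s u.

Lemma word_actM u v s : word_act (u * v) s = word_act u (word_act v s).
Proof. exact: foldr_cat. Qed.

Lemma reduced_word_act u s : reduced s -> reduced (word_act u s).
Proof. by move=> sR; elim: u => //= a u; apply: reduced_act. Qed.

Lemma act_inv x s : reduced s ->
  act (syllable_inv x) (act x s) = s /\ act x (act (syllable_inv x) s) = s.
Proof.
move=> sR; rewrite !act_act //; try by case: x.
by case: x => [a|b] /=; rewrite !act_trivial //= ?mulVg ?mulgV.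
Qed.

Lemma word_act_inv u s : reduced s -> word_act u^-1 (word_act u s) = s.
Proof.
move=> sR; elim: u => [//|[x b] u IHu].
have -> : ((x, b) :: u : word (G + H)%type)^-1 =
    (u : word _)^-1 * ([:: (x, ~~ b)] : word _).
  by rewrite -[LHS]/(word_inv _) /word_inv /= rev_cons -cats1.
rewrite word_actM /=.
have [xK1 xK2] := act_inv x (reduced_word_act u sR).
by case: b => /=; rewrite ?xK1 ?xK2.
Qed.

Lemma word_act_pres_rel u v : pres_rel (@free_product_relators G H) u v ->
  forall s, reduced s -> word_act u s = word_act v s.
Proof.
elim=> {u v} [//|u v _ IHu s sR|u v w _ IHu _ IHv s sR|u u' v v' _ IHu _ IHv s sR
  |u v _ IHu s sR|u s sR|r].
- by rewrite IHu.
- by rewrite IHu ?IHv.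
- by rewrite !word_actM IHv // IHu // reduced_word_act.
(* Writing [s] as [word_act v t] reduces the case of inverses to the induction hypothesis at [t]. *)
- set t := word_act v^-1 s.
  have tR : reduced t by apply: reduced_word_act.
  rewrite -[in LHS](_ : word_act v t = s); last first.
    by rewrite /t -{1}[v]invgK word_act_inv.
  by rewrite -IHu // word_act_inv.
- by rewrite word_actM word_act_inv.
- case=> a b s sR.
  all: rewrite !word_actM /= act_act ?reduced_act // act_act //= act_trivial //=.
  all: by rewrite mulgV.
Qed.

Lemma word_act_nil s : reduced s -> word_act [seq (x, false) | x <- s] [::] = s.
Proof.
elim: s => //= x s IHs; rewrite reduced_cons => /and3P[xN sR xs].
rewrite IHs //; case: s xs {IHs sR} => [|y s]; rewrite /= /ncons (negPf xN) //.
by move=> /negPf->.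
Qed.

(** Uniqueness of normal forms: acting on the empty word, [eval s] gives back [s]. *)
Lemma eval_inj s t : reduced s -> reduced t -> eval s = eval t -> s = t.
Proof.
have evalE s' : eval s' = \pi_(quot_group (pres_congruence (@free_product_relators G H)))
    [seq (x, false) | x <- s'].
  by rewrite genE /word_eval big_map.
move=> sR tR; rewrite !evalE => /quot_groupP /word_act_pres_rel/(_ [::] isT).
by rewrite !word_act_nil.
Qed.

Lemma eval_surj (p : P) : exists2 s, reduced s & eval s = p.
Proof.
have ex_act x p' : (exists2 s, reduced s & eval s = p') ->
    exists2 s, reduced s & eval s = syllable x * p'.
  by move=> [s sR <-]; exists (act x s); rewrite ?reduced_act ?eval_act.
elim/quotW: p => u; rewrite genE; elim: u => [|[x b] u IHu].
  by exists [::] => //; rewrite word_eval1 /eval big_nil.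
rewrite /word_eval big_cons; case: b => /=; last exact: ex_act IHu.
by rewrite -[_^-1]syllableV; apply: ex_act.
Qed.

End FreeProduct.

(** * Free products of groups of exponent two: involutions, center, endomorphisms *)

Section FreeProductInvolutions.
Variables G H : groupType.
Hypothesis GG : forall a : G, a * a = 1.
Hypothesis HH : forall b : H, b * b = 1.
Implicit Types (x y : G + H) (s t : seq (G + H)).

Local Notation P := (free_product G H).

Lemma eval_nil : eval [::] = 1 :> P.
Proof. exact: big_nil. Qed.

Lemma reduced_cat x s y t : reduced (x :: s ++ y :: t) =
  [&& reduced (x :: s), side (last x s) != side y & reduced (y :: t)].
Proof.
rewrite /reduced /= all_cat cat_path /=.
case: (trivial_syllable x); case: (trivial_syllable y); case: (all _ s);
  case: (all _ t); case: (path _ x s) => //=; by rewrite ?andbF.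
Qed.

Lemma reduced_rcons s x : reduced (rcons s x) =
  [&& reduced s, ~~ trivial_syllable x
    & if s is y :: s' then side (last y s') != side x else true].
Proof.
rewrite -cats1; case: s => [|y s] /=; first by rewrite reduced_cons.
rewrite reduced_cat (reduced_cons x) !andbT.
by congr (_ && _); rewrite andbC.
Qed.

Lemma reduced_rev s : reduced (rev s) = reduced s.
Proof.
rewrite /reduced all_rev rev_sorted; congr (_ && _).
by apply: eq_sorted => x y; rewrite eq_sym.
Qed.

Lemma reduced_eval_neq1 x s : reduced (x :: s) -> eval (x :: s) <> 1.
Proof. by move=> sR; rewrite -eval_nil => /(@eval_inj _ _ _ [::] sR isT). Qed.

(** When the two ends lie on different sides, copies of the word are concatenated without
    cancellation, so its powers have nonempty normal forms. *)
Lemma cyclically_reduced_expn x s n : reduced (x :: s) ->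
  side (last x s) != side x -> 0 < n -> eval (x :: s) ^+ n <> 1.
Proof.
move=> sR xs; case: n => // n _.
suff [t tR <-] : exists2 t, reduced (x :: t) & eval (x :: t) = eval (x :: s) ^+ n.+1.
  exact: reduced_eval_neq1.
elim: n => [|n [t tR tE]]; first by exists s.
exists (s ++ x :: t); first by rewrite reduced_cat sR xs.
by rewrite expgS -tE -eval_cat.
Qed.

Lemma eval_sqr_side x s : reduced (x :: s) -> eval (x :: s) * eval (x :: s) = 1 ->
  side (last x s) = side x.
Proof.
by move=> sR s2; apply/eqP; apply/idPn => /(cyclically_reduced_expn sR)/(_ (isT : 0 < 2)).
Qed.

Lemma syllable_sqr x : syllable x * syllable x = 1.
Proof.
rewrite -syllableM // syllable_trivial //.
by case: x => [a|b] /=; rewrite ?GG ?HH.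
Qed.

Lemma syllable_inv_sqr x : (syllable x)^-1 = syllable x.
Proof. exact/mulg1_eq/syllable_sqr. Qed.

Lemma syllable_comm x y : side x = side y -> commute (syllable x) (syllable y).
Proof.
move=> xy; rewrite /commute -!syllableM //; apply: (@invg_inj P).
by rewrite syllable_inv_sqr !syllableM // invgM !syllable_inv_sqr.
Qed.

Lemma eval_rev s : eval (rev s) = (eval s)^-1.
Proof.
elim: s => [|x s IHs]; first by rewrite eval_nil invg1.
by rewrite rev_cons eval_rcons eval_cons IHs invgM syllable_inv_sqr.
Qed.

Definition nrcons s x := if trivial_syllable x then s else rcons s x.

Lemma eval_nrcons s x : eval (nrcons s x) = eval s * syllable x.
Proof.
rewrite /nrcons; case: ifP => [/syllable_trivial->|_]; last exact: eval_rcons.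
by rewrite mulg1.
Qed.

Lemma size_nrcons s x : size (nrcons s x) <= (size s).+1.
Proof. by rewrite /nrcons; case: ifP; rewrite ?size_rcons. Qed.

Lemma reduced_nrcons s x y : reduced (rcons s x) -> side x = side y ->
  reduced (nrcons s y).
Proof.
rewrite reduced_rcons /nrcons => /and3P[sR _ xs] xy.
by case: ifPn => // yN; rewrite reduced_rcons sR yN -xy.
Qed.

(** Both ends of the normal form lie on the same side, by [eval_sqr_side]. Conjugation by the first
    syllable merges them and shortens the word, which allows induction on its length. *)
Lemma involution_conj_syllable (p : P) : p * p = 1 ->
  exists x g, p = syllable x ^ g.
Proof.
have [s] := eval_surj p; have [n] := ubnP (size s).
elim: n s p => // n IHn [|x s] p /= sn sR <- {p} s2.
  by exists (inl 1), 1; rewrite eval_nil conjg1 syllable_trivial /=.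
have xs := eval_sqr_side sR s2.
elim/last_ind: s => [|s y _] in sn sR s2 xs *.
  by exists x, 1; rewrite eval_cons eval_nil mulg1 conjg1.
move: xs; rewrite last_rcons => yx.
have evalE : eval (x :: rcons s y) ^ syllable x = eval (nrcons s (syllable_mul y x)).
  rewrite eval_cons eval_rcons eval_nrcons syllableM // /conjg !mulgA.
  by rewrite mulVg mul1g.
set t := nrcons s _ in evalE.
have [||||z [g zE]] := IHn t (eval t) => //.
- by apply: (leq_ltn_trans (size_nrcons _ _)); rewrite size_rcons ltnS in sn.
- move: sR; rewrite reduced_cons => /and3P[_ /reduced_nrcons sR _].
  by apply: sR; rewrite side_mul // yx.
- by rewrite -evalE -conjMg s2 conj1g.
exists z, (g * (syllable x)^-1).
by rewrite conjgM -zE -evalE conjgK.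
Qed.

Lemma syllable_mul_expn x y s n : ~~ trivial_syllable x -> side x != side y ->
  reduced (y :: s) -> eval (y :: s) * eval (y :: s) = 1 -> 0 < n ->
  (syllable x * eval (y :: s)) ^+ n <> 1.
Proof.
move=> xN xy sR s2 n_gt0; rewrite -eval_cons; apply: cyclically_reduced_expn => //.
  by rewrite reduced_cons xN sR.
by rewrite /= eval_sqr_side // eq_sym.
Qed.

(** If [p] starts on the other side, [syllable x * p] is cyclically reduced and has infinite order.
    If [p] starts on the side of [x] and has several syllables, conjugation by the first one fixes
    [syllable x], as the factors are commutative, and leads back to the previous case. *)
Lemma finite_dihedral_syllable x (p : P) n : ~~ trivial_syllable x ->
  p * p = 1 -> 0 < n -> (syllable x * p) ^+ n = 1 ->
  exists2 y, side y = side x & p = syllable y.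
Proof.
move=> xN; have [[|y s] sR <-] := eval_surj p => p2 n_gt0 xpn.
  (* The empty word is the trivial syllable on the side of [x]. *)
  exists (syllable_mul x x); first exact: side_mul.
  by rewrite eval_nil syllableM // syllable_sqr.
have [xy|xy] := eqVneq (side x) (side y); last first.
  by case: (syllable_mul_expn xN xy sR p2 n_gt0).
have ys := eval_sqr_side sR p2.
elim/last_ind: s => [|s z _] in sR p2 xpn ys *.
  by exists y; rewrite // eval_cons eval_nil mulg1.
move: ys; rewrite last_rcons => zy; exfalso.
have evalE : eval (y :: rcons s z) ^ syllable y = eval (nrcons s (syllable_mul z y)).
  rewrite eval_cons eval_rcons eval_nrcons syllableM // /conjg !mulgA.
  by rewrite mulVg mul1g.
move: sR; rewrite reduced_cons => /and3P[_ szR ys].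
have sR : reduced (nrcons s (syllable_mul z y)).
  by apply: reduced_nrcons szR _; rewrite side_mul // zy.
case: s => [|u s] /= in szR ys evalE p2 xpn sR *; first by rewrite zy eqxx in ys.
have [t tE] : exists t, nrcons (u :: s) (syllable_mul z y) = u :: t.
  by rewrite /nrcons; case: ifP => _; [exists s | exists (rcons s (syllable_mul z y))].
rewrite tE in sR evalE; rewrite -xy in ys.
apply: (syllable_mul_expn xN ys sR _ n_gt0).
  by rewrite -evalE -conjMg p2 conj1g.
rewrite -evalE -[X in X * _](_ : syllable x ^ syllable y = _); last first.
  by apply/conjg_fixP/commgP/syllable_comm.
by rewrite -conjMg -conjXg xpn conj1g.
Qed.

(** Take a nontrivial syllable [y] on the side opposite to the head of [p]. The normal form of
    [y * p] is that of [p] preceded by [y], whereas that of [p * y] has another head or is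
    shorter. *)
Lemma free_product_centerless (a0 : G) (b0 : H) (p : P) : a0 <> 1 -> b0 <> 1 ->
  (forall q, commute p q) -> p = 1.
Proof.
move=> /eqP a0N /eqP b0N; have [[|x s] sR <-] := eval_surj p.
  by move=> _; apply: eval_nil.
move=> pC; exfalso.
have [y [yN yx]] : exists y, ~~ trivial_syllable y /\ side y != side x.
  by case: (side x); [exists (inr b0) | exists (inl a0)].
have yR : reduced (y :: x :: s) by rewrite reduced_cons yN sR.
have [ys|ys] := eqVneq (side (last x s)) (side y); last first.
  have /(eval_inj _ yR) : eval (rcons (x :: s) y) = eval (y :: x :: s).
    by rewrite eval_rcons (eval_cons y); apply: pC.
  rewrite reduced_rcons sR yN ys => /(_ isT) [xy _].
  by rewrite xy eqxx in yx.
elim/last_ind: s => [|s z _] in sR yR pC ys; first by rewrite -ys eqxx in yx.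
rewrite last_rcons in ys.
rewrite -rcons_cons in sR.
have /(eval_inj (reduced_nrcons sR _) yR) : 
    eval (nrcons (x :: s) (syllable_mul z y)) = eval (y :: x :: rcons s z).
  by rewrite eval_nrcons syllableM // mulgA -eval_rcons (eval_cons y); apply: pC.
rewrite side_mul // => /(_ ys) /(congr1 size) /=.
by apply/eqP; rewrite ltn_eqF // size_rcons ltnS size_nrcons.
Qed.

(** Consecutive blocks meet at ends lying on the sides of the syllables they replace, so no
    cancellation occurs. This yields normal forms of images under an endomorphism. *)
Lemma reduced_flatten (F : G + H -> seq (G + H)) s :
  (forall x, ~~ trivial_syllable x -> exists y t,
     [/\ F x = y :: t, reduced (y :: t), side y = side x & side (last y t) = side x]) ->
  reduced s -> reduced (flatten [seq F x | x <- s]).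
Proof.
move=> FP; elim: s => //= x s IHs; rewrite reduced_cons => /and3P[xN sR xs].
have [y [t [-> tR _ tx]]] := FP x xN.
case: s => [|z s] /= in IHs sR xs *; first by rewrite cats0.
move: (sR); rewrite reduced_cons => /andP[zN _].
have [z' [t' [E _ zz' _]]] := FP z zN; rewrite E /= in IHs *.
by rewrite reduced_cat tR tx zz' xs IHs.
Qed.

(** In [conj_factor_surj] the two outer terms are absorbed by the commutative factors, so that only
    the middle word [s] matters. *)
Lemma strip_syllables (p : P) : exists b s a, [/\ p = inR G b * eval s * inL H a,
  reduced s & s = [::] \/ exists x t y u,
    [/\ s = x :: t, s = rcons u y, side x = true & side y = false]].
Proof.
have [s sR <-] := eval_surj p.
have [b [t [-> tR th]]] : exists b t, [/\ eval s = inR G b * eval t, reduced t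
    & t = [::] \/ exists x t', t = x :: t' /\ side x].
  case: s sR => [|[a|b] s] sR.
  - by exists 1, [::]; split; [rewrite hom1 mul1g | | left].
  - by exists 1, (inl a :: s); split; [rewrite hom1 mul1g | | right; exists (inl a), s].
  move: sR; rewrite reduced_cons => /and3P[_ sR xs].
  exists b, s; split=> //; first exact: eval_cons.
  by case: s xs {sR} => [|y s] xs; [left | right; exists y, s; move: xs; case: (y)].
case/lastP: t tR th => [|t [a|c]] tR th.
- by exists b, [::], 1; split; [rewrite hom1 mulg1 | | left].
- exists b, t, a; split; first by rewrite eval_rcons mulgA.
    by move: tR; rewrite reduced_rcons => /andP[].
  case: th => [|[x [t' [tE xL]]]]; first by case: (t).
  case/lastP: t => [|t y] in tR tE *; [by left | right].
  case: t => [|z t] in tR tE *.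
    case: tE => yx _; exfalso; move: tR.
    by rewrite yx /= reduced_cons /= xL !andbF.
  case: tE => zx _; exists x, (rcons t y), y, (z :: t); split=> //; first by rewrite zx.
  move: tR; rewrite reduced_rcons /= last_rcons.
  by case: y => //= a'; rewrite !andbF.
exists b, (rcons t (inr c)), 1; split=> //; first by rewrite hom1 mulg1.
right; case: th => [|[x [t' [tE xL]]]]; first by case: (t).
by exists x, t', (inr c), t.
Qed.

(** If the middle word [s] of [p] is nonempty, then, up to conjugation, [phi] replaces each right
    syllable by a block of length at least three and keeps the left ones. Reduced words go to
    reduced words, so no image is a single right syllable. *)
Lemma conj_factor_surj (b0 : H) (phi : {multiplicative P -> P}) (p : P) : b0 <> 1 ->
  (forall a, phi (inL H a) = inL H a) ->
  (forall b, phi (inR G b) = inR G b ^ p) -> (forall q, exists z, phi z = q) ->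
  exists b a, p = inR G b * inL H a.
Proof.
move=> /eqP b0N phiL phiR phi_surj.
have [b [s [a [pE sR sH]]]] := strip_syllables p.
case: sH pE => [->|[x [t [y [u [sE sE' xL yR]]]]]] pE.
  by exists b, a; rewrite pE eval_nil mulg1.
(* This conjugation removes the last term of [p] and still fixes the left factor pointwise. *)
exfalso; pose psi z := phi z ^ (inL H a)^-1.
have psiM z z' : psi (z * z') = psi z * psi z' by rewrite /psi gmulfM conjMg.
have psiL c : psi (inL H c) = inL H c.
  rewrite /psi phiL; apply/conjg_fixP/commgP/commuteV.
  exact: (@syllable_comm (inl c) (inl a)).
have psiR c : psi (inR G c) = inR G c ^ eval s.
  rewrite /psi phiR pE !conjgM conjgK; congr (_ ^ _).
  by apply/conjg_fixP/commgP; apply: (@syllable_comm (inr c) (inr b)).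
(* [F z] spells the image of a syllable: [rev s] evaluates to the inverse of [eval s], since
   syllables are involutions. *)
pose F (z : G + H) := if side z then [:: z] else rev s ++ z :: s.
have FE z : psi (syllable z) = eval (F z).
  case: z => [c|c]; rewrite /F /=.
    by rewrite eval_cons eval_nil mulg1; apply: psiL.
  by rewrite eval_cat eval_cons eval_rev; apply: psiR.
have [z0 z0E] := phi_surj (inR G b0 ^ inL H a).
have {z0E} : psi z0 = inR G b0 by rewrite /psi z0E conjgK.
have [w wR <-] := eval_surj z0.
have -> : psi (eval w) = eval (flatten [seq F z | z <- w]).
  elim: (w) => [|z w' IHw] /=; first by rewrite eval_nil /psi hom1 conj1g.
  by rewrite eval_cons psiM FE IHw eval_cat.
have -> : inR G b0 = eval [:: inr b0] by rewrite eval_cons eval_nil mulg1.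
have FP z : ~~ trivial_syllable z -> exists y t,
     [/\ F z = y :: t, reduced (y :: t), side y = side z & side (last y t) = side z].
  case: z => c cN; first by exists (inl c), [::]; rewrite reduced_cons cN.
  (* The block of a right syllable begins and ends with [y], the last syllable of [s], which is
     itself a right one. *)
  exists y, (rev u ++ inr c :: s); rewrite /F /= last_cat /=; split=> //.
  - by rewrite {1}sE' rev_rcons.
  - rewrite reduced_cat -rev_rcons -sE' reduced_rev sR /= reduced_cons cN sR.
    rewrite -(last_cons y) -rev_rcons -sE' sE rev_cons last_rcons xL.
    by rewrite eq_sym.
  - by rewrite sE' last_rcons yR.
move/eval_inj; rewrite reduced_flatten // reduced_cons b0N => /(_ isT isT).
case: w wR => // -[c|c] w wR //= /(congr1 size).
by rewrite /F /= !size_cat /= size_rev sE /= addnS addSn.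
Qed.

End FreeProductInvolutions.

(** * Elementary abelian 2-groups *)

(** Packs a morphism from a function and a proof that are only available locally. *)
Definition hom_of (G H : groupType) (f : G -> H) (fM : {morph f : x y / x * y}) :
    {multiplicative G -> H} :=
  HB.pack_for {multiplicative G -> H} f (isMultiplicative.Build G H f fM).

Lemma isomorphic_bij (G H : groupType) (f : {multiplicative G -> H}) :
  injective f -> (forall y, exists x, f x = y) -> isomorphic H G.
Proof.
move=> f_inj /choice[g gK]; have fK : cancel f g by move=> x; apply/f_inj/gK.
by exists (hom_of (can2_gmulfM fK gK)); exists f.
Qed.

(** * Functoriality of the free product *)

Section FreeProductMap.
Variables (G G' H H' : groupType).

Definition free_map (f : {multiplicative G -> G'}) (g : {multiplicative H -> H'}) :=
  free_lift (@inL G' H' \o f) (@inR G' H' \o g).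

HB.instance Definition _ f g := Multiplicative.on (free_map f g).

Lemma free_map_inL f g a : free_map f g (inL H a) = inL H' (f a).
Proof. exact: free_lift_inL. Qed.

Lemma free_map_inR f g b : free_map f g (@inR G H b) = @inR G' H' (g b).
Proof. exact: free_lift_inR. Qed.

End FreeProductMap.

Lemma free_mapK (G G' H H' : groupType)
    (f : {multiplicative G -> G'}) (f' : {multiplicative G' -> G})
    (g : {multiplicative H -> H'}) (g' : {multiplicative H' -> H}) :
  cancel f f' -> cancel g g' -> cancel (free_map f g) (free_map f' g').
Proof.
move=> fK gK p; rewrite -[LHS]/((free_map f' g' \o free_map f g) p).
rewrite -[RHS]/(idfun p); apply: free_product_ext p => [a|b] /=.
  by rewrite !free_map_inL fK.
by rewrite !free_map_inR gK.
Qed.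

Lemma isomorphic_free_product (G G' H H' : groupType) :
  isomorphic G G' -> isomorphic H H' ->
  isomorphic (free_product G H) (free_product G' H').
Proof.
move=> [f [f' fK f'K]] [g [g' gK g'K]]; exists (free_map f g).
exists (free_map (hom_of (can2_gmulfM fK f'K)) (hom_of (can2_gmulfM gK g'K))).
  exact: free_mapK.
exact: free_mapK.
Qed.

(** * Bases of finitely generated elementary abelian 2-groups *)

Section ElementaryAbelian.
Variable A : groupType.
Hypothesis Acomm : forall a b : A, commute a b.
Hypothesis AA : forall a : A, a * a = 1.

(** Makes [a ^+ i] multiplicative in [i : 'Z_2], whose law is addition modulo 2. *)
Lemma expg_mod2 (a : A) n : a ^+ (n %% 2) = a ^+ n.
Proof. by rewrite {2}(divn_eq n 2) expgnDr mulnC expgnA expg2 AA expg1n mul1g. Qed.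

(** A basis is extracted greedily from the list: an element outside the range of the current [phi]
    provides a new coordinate. *)
Lemma Z2_power_embedding (s : seq A) : exists n (phi : {multiplicative Z2_power n -> A}),
  injective phi /\ {in s, forall a, exists x, phi x = a}.
Proof.
elim: s => [|a s [n [phi [phi_inj phi_s]]]].
  exists 0, (hom_of (fun _ _ : Z2_power 0 => esym (mul1g (1 : A)))); split=> // x y _.
  by apply/ffunP => -[].
have [[x0 x0a]|a_notin] := pselect (exists x, phi x = a).
  exists n, phi; split=> // b; rewrite inE => /predU1P[->|]; last exact: phi_s.
  by exists x0.
pose tl (x : Z2_power n.+1) : Z2_power n := [ffun i => x (lift ord0 i)].
pose psi (x : Z2_power n.+1) : A := a ^+ (x ord0 : nat) * phi (tl x).
have psiM : {morph psi : x y / x * y}.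
  move=> x y; rewrite /psi.
  have -> : tl (x * y) = tl x * tl y by apply/ffunP => i; rewrite !ffunE.
  rewrite gmulfM ffunE /= expg_mod2 expgnDr -!mulgA; congr (_ * _).
  by rewrite !mulgA; congr (_ * _); apply: Acomm.
exists n.+1, (hom_of psiM); split => /=.
  (* In the kernel the coordinate of [a] vanishes, as otherwise [a] would lie in the range of
     [phi]. *)
  have psi1 x : psi x = 1 -> x = 1.
    rewrite /psi; case x0: (x ord0) => [[|[|//]] i] /= xphi.
      have tx : tl x = 1 by apply: phi_inj; rewrite hom1 -xphi mul1g.
      apply/ffunP => j; case: (unliftP ord0 j) => [j'|] ->.
        by have /ffunP/(_ j') := tx; rewrite !ffunE.
      by rewrite x0 ffunE; apply: val_inj.
    case: a_notin; exists (tl x)^-1; rewrite homV.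
    by apply: invg_inj; rewrite invgK; apply/esym/mulg1_eq.
  move=> x y xy; apply/divg1_eq/psi1.
  have psiV : psi y^-1 = (psi y)^-1 := homV (hom_of psiM) y.
  by rewrite psiM psiV xy mulgV.
pose hd (b : bool) (x : Z2_power n) : Z2_power n.+1 :=
  [ffun i => if unlift ord0 i is Some j then x j else inZp b].
have tl_hd b x : tl (hd b x) = x by apply/ffunP => i; rewrite !ffunE liftK.
move=> b; rewrite inE => /predU1P[->|/phi_s[x <-]].
  by exists (hd true 1); rewrite /psi tl_hd hom1 ffunE unlift_none mulg1.
by exists (hd false x); rewrite /psi tl_hd ffunE unlift_none mul1g.
Qed.

(** Generation by [s] is phrased as an induction principle, to be applied to the range of the
    embedding. *)
Lemma elementary_abelian_iso (s : seq A) :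
  (forall Q : A -> Prop, Q 1 -> (forall a b, Q a -> Q b -> Q (a * b)) ->
     {in s, forall a, Q a} -> forall a, Q a) ->
  exists n, isomorphic A (Z2_power n).
Proof.
move=> s_gen; have [n [phi [phi_inj phi_s]]] := Z2_power_embedding s.
exists n; apply: (isomorphic_bij phi_inj); apply: s_gen => //.
  by exists 1; apply: hom1.
by move=> _ _ [x <-] [y <-]; exists (x * y); apply: gmulfM.
Qed.

Lemma Z2_power_gt0 (a : A) n : a <> 1 -> isomorphic A (Z2_power n) -> 0 < n.
Proof.
move=> aN [f /bij_inj f_inj]; case: n f f_inj => // f f_inj.
by case: aN; apply: f_inj; apply/ffunP => -[].
Qed.

End ElementaryAbelian.

(** * Projections of a free product onto its factors *)

Section FreeProductProjections.
Variables G H : groupType.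

Definition const1_hom (K L : groupType) : {multiplicative K -> L} :=
  hom_of (fun _ _ : K => esym (mul1g (1 : L))).

Definition projL : {multiplicative free_product G H -> G} :=
  free_lift idfun (const1_hom H G).
Definition projR : {multiplicative free_product G H -> H} :=
  free_lift (const1_hom G H) idfun.

Lemma projL_inL a : projL (inL H a) = a. Proof. exact: free_lift_inL. Qed.
Lemma projL_inR b : projL (inR G b) = 1. Proof. exact: free_lift_inR. Qed.
Lemma projR_inL a : projR (inL H a) = 1. Proof. exact: free_lift_inL. Qed.
Lemma projR_inR b : projR (inR G b) = b. Proof. exact: free_lift_inR. Qed.

Hypothesis GG : forall a : G, a * a = 1.
Hypothesis HH : forall b : H, b * b = 1.
Hypothesis Gcomm : forall a b : G, commute a b.
Hypothesis Hcomm : forall a b : H, commute a b.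

Lemma projL_conj a g : projL (inL H a ^ g) = a.
Proof. by rewrite homJ projL_inL; apply/conjg_fixP/commgP/Gcomm. Qed.

Lemma projR_conj b g : projR (inR G b ^ g) = b.
Proof. by rewrite homJ projR_inR; apply/conjg_fixP/commgP/Hcomm. Qed.

(** As the factors are commutative, a projection recovers a factor element from any of its
    conjugates. *)
Lemma involution_cases (p : free_product G H) : p * p = 1 ->
  (projR p = 1 /\ exists g, p = inL H (projL p) ^ g) \/
  (projL p = 1 /\ exists g, p = inR G (projR p) ^ g).
Proof.
move=> /involution_conj_syllable[[a|b] [g ->]]; [left | right].
  by split; [rewrite homJ projR_inL conj1g | exists g; rewrite projL_conj].
by split; [rewrite homJ projL_inR conj1g | exists g; rewrite projR_conj].
Qed.

Lemma dihedral_inL a g (p : free_product G H) n : a <> 1 -> p * p = 1 -> 0 < n ->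
  (inL H a ^ g * p) ^+ n = 1 -> p = inL H (projL p) ^ g.
Proof.
move=> /eqP aN p2 n_gt0 apn.
have [||[b|//] _ pE] :=
  @finite_dihedral_syllable _ _ GG HH (inl a) (p ^ g^-1) n aN _ n_gt0.
- by rewrite -conjMg p2 conj1g.
- by rewrite -[syllable _](conjgK g) -conjMg -conjXg apn conj1g.
by rewrite -[p](conjgKV g) pE projL_conj.
Qed.

Lemma dihedral_inR b g (p : free_product G H) n : b <> 1 -> p * p = 1 -> 0 < n ->
  (inR G b ^ g * p) ^+ n = 1 -> p = inR G (projR p) ^ g.
Proof.
move=> /eqP bN p2 n_gt0 bpn.
have [||[//|a] _ pE] :=
  @finite_dihedral_syllable _ _ GG HH (inr b) (p ^ g^-1) n bN _ n_gt0.
- by rewrite -conjMg p2 conj1g.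
- by rewrite -[syllable _](conjgK g) -conjMg -conjXg bpn conj1g.
by rewrite -[p](conjgKV g) pE projR_conj.
Qed.

End FreeProductProjections.

(** * Connected components of a Coxeter graph *)

Section Components.
Variable Gamma : coxeter_graph.
Local Notation adj := (@adjacent Gamma).

Lemma adjacent_connect_sym : connect_sym adj.
Proof. by apply: sym_connect_sym => v w; rewrite /adjacent finset.setUC. Qed.

Definition component := {E : {set vertex Gamma} | E \in components Gamma}.

Lemma component_connect (E : component) v w :
  v \in val E -> (w \in val E) = connect adj v w.
Proof.
case: E => E /= /imsetP[u _ ->]; rewrite !inE /= => uv.
exact: same_connect adjacent_connect_sym _ _ uv w.
Qed.

Lemma component_neq0 (E : component) : exists v, v \in val E.
Proof. by case: E => E /= /imsetP[u _ ->]; exists u; rewrite !inE /=. Qed.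

Lemma component_of v : exists E : component, v \in val E.
Proof.
have EP : [set w in [set: vertex Gamma] | connect adj v w] \in components Gamma.
  by apply: imset_f.
by exists (exist (fun E => E \in components Gamma) _ EP); rewrite !inE /=.
Qed.

Lemma component_inj (E F : component) v : v \in val E -> v \in val F -> E = F.
Proof.
move=> vE vF; apply/val_inj/finset.setP => w.
by rewrite (component_connect _ vE) (component_connect _ vF).
Qed.

Lemma component_adjacent (E : component) v w :
  adj v w -> (v \in val E) = (w \in val E).
Proof.
move=> vw; apply/idP/idP => [vE|wE].
  by rewrite (component_connect _ vE) connect1.
by rewrite (component_connect _ wE) adjacent_connect_sym connect1.
Qed.

End Components.

(** * Universal property and abelianization of Coxeter groups *)

Section CoxeterHom.
Variable Gamma : coxeter_graph.

Definition coxeter_gen (v : vertex Gamma) : coxeter_group Gamma :=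
  gen (@coxeter_relators Gamma) v.

Lemma coxeter_gen_sqr v : coxeter_gen v * coxeter_gen v = 1.
Proof.
by have := gen_relator (CoxeterVertex v); rewrite word_evalX word_eval_letter.
Qed.

Lemma coxeter_gen_edge v w : [set v; w] \in edge Gamma ->
  (coxeter_gen v * coxeter_gen w) ^+ label [set v; w] = 1.
Proof.
move=> /CoxeterEdge/gen_relator.
by rewrite word_evalX word_evalM !word_eval_letter.
Qed.

Lemma coxeter_hom (K : groupType) (h : vertex Gamma -> K) :
  (forall v, h v * h v = 1) ->
  (forall v w, [set v; w] \in edge Gamma -> (h v * h w) ^+ label [set v; w] = 1) ->
  exists f : {multiplicative coxeter_group Gamma -> K}, forall v, f (coxeter_gen v) = h v.
Proof.
move=> h2 hE.
have hR r : coxeter_relators r -> word_eval h r = 1.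
  case=> [v|v w /hE vw]; first by rewrite word_evalX word_eval_letter; apply: h2.
  by rewrite word_evalX word_evalM !word_eval_letter.
by exists (hom_of (presented_liftM hR)); apply: presented_lift_gen.
Qed.

Lemma coxeter_ind (Q : coxeter_group Gamma -> Prop) :
  Q 1 -> (forall x y, Q x -> Q y -> Q (x * y)) -> (forall v, Q (coxeter_gen v)) ->
  forall x, Q x.
Proof.
move=> Q1 QM Qgen; elim/presented_ind => // v.
by rewrite (mulg1_eq (coxeter_gen_sqr v)); apply: Qgen.
Qed.

End CoxeterHom.

Section CoxeterAbelianization.
Variable Gamma : coxeter_graph.
Local Notation A := (abelianization (coxeter_group Gamma)).

Lemma coxeter_ab_sqr (a : A) : a * a = 1.
Proof.
have [x <-] := to_ab_surj a; elim/coxeter_ind: x => [|x y x2 y2|v].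
- by rewrite hom1 mulg1.
- rewrite gmulfM mulgA -[_ * to_ab x]mulgA (abelianization_comm (to_ab y)) mulgA x2.
  by rewrite mul1g.
- by rewrite -gmulfM coxeter_gen_sqr hom1.
Qed.

(** Detected by sending every vertex to the generator of Z/2: a product of two vertices then becomes
    trivial, so the edge relators hold whatever their labels. *)
Lemma coxeter_ab_gen_neq1 (v : vertex Gamma) : to_ab (coxeter_gen v) <> 1.
Proof.
pose e : 'Z_2 := inZp 1; have e2 : e * e = 1 :> 'Z_2 by apply: val_inj.
have [|v' w' _|f fE] := @coxeter_hom Gamma 'Z_2 (fun=> e).
- by move=> _; apply: e2.
- by rewrite e2 expg1n.
have Z2C (a b : 'Z_2) : commute a b by apply: val_inj; rewrite /= addnC.
move=> /(congr1 (ab_lift f)); rewrite ab_lift_to_ab // fE.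
by rewrite (hom1 (hom_of (ab_liftM f Z2C))).
Qed.

Lemma coxeter_ab_iso : exists n, isomorphic A (Z2_power n).
Proof.
apply: (@elementary_abelian_iso A (@abelianization_comm _) coxeter_ab_sqr
  [seq to_ab (coxeter_gen v) | v <- enum (vertex Gamma)]) => Q Q1 QM Qs a.
have [x <-] := to_ab_surj a; elim/coxeter_ind: x => [|x y|v].
- by rewrite hom1.
- by rewrite gmulfM; apply: QM.
- by apply/Qs/map_f; rewrite mem_enum.
Qed.

End CoxeterAbelianization.

(** * Retractions of a Coxeter group onto its components *)

Section Retractions.
Variable Gamma : coxeter_graph.
Local Notation W := (coxeter_group Gamma).
Local Notation A E := (abelianization (coxeter_group (induced E))).

Definition ab_vertex (E : {set vertex Gamma}) (v : vertex Gamma) : A E :=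
  if insub v is Some u then to_ab (@coxeter_gen (induced E) u) else 1.

Lemma ab_vertex_in (E : {set vertex Gamma}) (u : {v | v \in E}) :
  ab_vertex E (val u) = to_ab (@coxeter_gen (induced E) u).
Proof. by rewrite /ab_vertex valK. Qed.

Lemma ab_vertex_out (E : {set vertex Gamma}) v : v \notin E -> ab_vertex E v = 1.
Proof. by move=> vE; rewrite /ab_vertex insubN. Qed.

Lemma ab_vertex_neq1 (E : {set vertex Gamma}) v : v \in E -> ab_vertex E v <> 1.
Proof.
move=> vE; rewrite -[v]/(val (exist (fun v => v \in E) v vE)) ab_vertex_in.
exact: coxeter_ab_gen_neq1.
Qed.

(** An edge has both ends inside the component or both outside, so its relator holds in the induced
    group or becomes trivial. *)
Lemma ab_vertex_edge (E : component Gamma) v w : [set v; w] \in edge Gamma ->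
  (ab_vertex (val E) v * ab_vertex (val E) w) ^+ label [set v; w] = 1.
Proof.
move=> vw; have := component_adjacent E vw; case: (boolP (v \in val E)) => vE wE.
  pose v' := exist (fun v => v \in val E) v vE.
  pose w' := exist (fun v => v \in val E) w (esym wE).
  have vwE : val @: [set v'; w'] = [set v; w] :> {set vertex Gamma}.
    by rewrite imsetU1 imset_set1.
  rewrite -[v]/(val v') -[w]/(val w') !ab_vertex_in -gmulfM -homX.
  have := @coxeter_gen_edge (induced (val E)) v' w'.
  rewrite inE vwE => /(_ vw).
  rewrite -[label _]/(label (val @: [set v'; w'])) vwE => ->.
  exact: hom1.
by rewrite !ab_vertex_out ?mulg1 ?expg1n // -wE.
Qed.

Lemma retraction_exists (E : component Gamma) :
  {r : {multiplicative W -> A (val E)} |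
    forall v, r (coxeter_gen v) = ab_vertex (val E) v}.
Proof.
apply: cid; apply: coxeter_hom => [v|]; first exact: coxeter_ab_sqr.
exact: ab_vertex_edge.
Qed.

Definition retraction (E : component Gamma) : {multiplicative W -> A (val E)} :=
  projT1 (retraction_exists E).

Lemma retraction_gen (E : component Gamma) v :
  retraction E (coxeter_gen v) = ab_vertex (val E) v.
Proof. exact: projT2 (retraction_exists E) v. Qed.

(** Distinct components are disjoint and no edge joins them, so each relator is evaluated inside a
    single factor. *)
Lemma retraction_pair_exists (E F : component Gamma) : E <> F ->
  exists q : {multiplicative W -> free_product (A (val E)) (A (val F))},
    forall v, q (coxeter_gen v) =
      inL _ (ab_vertex (val E) v) * inR _ (ab_vertex (val F) v).
Proof.
move=> EF; have out v : v \in val E -> ab_vertex (val F) v = 1.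
  by move=> vE; apply/ab_vertex_out/negP => vF; apply/EF/(component_inj vE vF).
apply: coxeter_hom => [v|v w vw].
  case: (boolP (v \in val E)) => [/out->|/ab_vertex_out->].
    by rewrite hom1 mulg1 -gmulfM coxeter_ab_sqr hom1.
  by rewrite hom1 mul1g -gmulfM coxeter_ab_sqr hom1.
have := component_adjacent E vw; case: (boolP (v \in val E)) => vE wE.
  rewrite !out // hom1 !mulg1 -gmulfM -homX.
  by rewrite ab_vertex_edge ?hom1.
rewrite (ab_vertex_out vE) (@ab_vertex_out _ w) -?wE // hom1 !mul1g -gmulfM -homX.
by rewrite ab_vertex_edge ?hom1.
Qed.

Lemma Z2_comm (a b : 'Z_2) : commute a b.
Proof. by apply: val_inj; rewrite /= addnC. Qed.

(** A homomorphism to Z/2 factors through the product of the abelianized component groups. *)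
Lemma retractions_separate (t : {multiplicative W -> 'Z_2}) x :
  (forall E, retraction E x = 1) -> t x = 1.
Proof.
have tE (E : component Gamma) : {t' : {multiplicative A (val E) -> 'Z_2} |
    forall v, v \in val E -> t' (ab_vertex (val E) v) = t (coxeter_gen v)}.
  apply: cid.
  have [u|u u' uu'|f fE] := @coxeter_hom (induced (val E)) 'Z_2
    (fun u => t (coxeter_gen (val u))).
  - by rewrite -gmulfM coxeter_gen_sqr hom1.
  - rewrite -gmulfM -homX; rewrite inE in uu'.
    have uuE : val @: [set u; u'] = [set val u; val u'] by rewrite imsetU1 imset_set1.
    rewrite -[label _]/(label (val @: [set u; u'])) uuE coxeter_gen_edge ?hom1 //.
    by rewrite -uuE.
  - exists (hom_of (ab_liftM f Z2_comm)) => v vE.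
    rewrite -[v]/(val (exist (fun v => v \in val E) v vE)) ab_vertex_in.
    by rewrite /= ab_lift_to_ab ?fE //; apply: Z2_comm.
(* On a generator only the factor of its own component survives, which gives [t = T]. *)
pose T y := \prod_(E : component Gamma) projT1 (tE E) (retraction E y).
have TM : {morph T : y z / y * z}.
  move=> y z; rewrite /T -prodgM_commute; last by move=> *; apply: Z2_comm.
  by apply: eq_bigr => E _; rewrite !gmulfM.
have tT : t =1 hom_of TM.
  apply: presented_ext => v; rewrite -/(coxeter_gen v) /= /T.
  have [E vE] := component_of v.
  rewrite -[LHS](projT2 (tE E) v vE) -retraction_gen.
  rewrite (eq_bigr (fun F =>
    if F == E then projT1 (tE E) (retraction E (coxeter_gen v)) else 1)).
    by rewrite -big_mkcond big_pred1_eq.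
  move=> F _; case: eqP => [->//|FE].
  rewrite retraction_gen ab_vertex_out ?hom1 //.
  by apply/negP => vF; apply/FE/(component_inj vF vE).
move=> x1; rewrite tT /= /T big1 // => E _.
by rewrite x1 hom1.
Qed.

End Retractions.

(** * Action of an automorphism on the components *)

Section ComponentPermutation.
Variable Gamma : coxeter_graph.
Local Notation W := (coxeter_group Gamma).
Local Notation A E := (abelianization (coxeter_group (induced E))).
Variable f : automorphism W.

Definition aut_hom : {multiplicative W -> W} := hom_of (aut_funP f).1.

Local Notation image v := (aut_hom (coxeter_gen v)).

Lemma aut_hom_surj y : exists x, aut_hom x = y.
Proof. by exists (aut_inv f y); apply: (aut_invK f).2. Qed.

Lemma image_sqr v : image v * image v = 1.
Proof. by rewrite -gmulfM coxeter_gen_sqr hom1. Qed.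

Lemma image_edge v w : [set v; w] \in edge Gamma ->
  exists2 n, 0 < n & (image v * image w) ^+ n = 1.
Proof.
move=> vw; exists (label [set v; w]); first exact: ltnW (label_ge2 vw).
by rewrite -gmulfM -homX coxeter_gen_edge // hom1.
Qed.

(** The homomorphism to Z/2 that is nontrivial on every vertex, composed with the inverse of [f],
    does not kill [image v]; hence some retraction does not either. *)
Lemma retraction_image_exists v : exists E, retraction E (image v) <> 1.
Proof.
apply: contrapT => /forallNP nE.
have e2 : inZp 1 * inZp 1 = 1 :> 'Z_2 by apply: val_inj.
have [|v' w' _|t tE] := @coxeter_hom Gamma 'Z_2 (fun=> inZp 1).
- by move=> _; apply: e2.
- by rewrite e2 expg1n.
have /= := @retractions_separate _ (t \o hom_of (aut_funP (aut_inv f)).1) (image v).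
rewrite (aut_invK f).1 tE => H.
have /(congr1 val) // : inZp 1 = 1 :> 'Z_2.
by apply: H => E; apply: contrapT; apply: nE.
Qed.

Section Pair.
Variables (E F : component Gamma).
Variable q : {multiplicative W -> free_product (A (val E)) (A (val F))}.
Hypothesis qE : forall v,
  q (coxeter_gen v) = inL _ (ab_vertex (val E) v) * inR _ (ab_vertex (val F) v).

Lemma projL_retraction x : projL _ _ (q x) = retraction E x.
Proof.
rewrite -[LHS]/((projL _ _ \o q) x); apply: presented_ext x => v /=.
rewrite -/(coxeter_gen v) qE gmulfM projL_inL projL_inR mulg1.
by rewrite retraction_gen.
Qed.

Lemma projR_retraction x : projR _ _ (q x) = retraction F x.
Proof.
rewrite -[LHS]/((projR _ _ \o q) x); apply: presented_ext x => v /=.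
rewrite -/(coxeter_gen v) qE gmulfM projR_inL projR_inR mul1g.
by rewrite retraction_gen.
Qed.

Lemma q_image_sqr v : q (image v) * q (image v) = 1.
Proof. by rewrite -gmulfM image_sqr hom1. Qed.

Lemma q_image_cases v :
  (retraction F (image v) = 1 /\
   exists g, q (image v) = inL _ (retraction E (image v)) ^ g) \/
  (retraction E (image v) = 1 /\
   exists g, q (image v) = inR _ (retraction F (image v)) ^ g).
Proof.
rewrite -projL_retraction -projR_retraction.
apply: involution_cases; try exact: abelianization_comm.
exact: q_image_sqr.
Qed.

Lemma q_image_edgeL v w g : [set v; w] \in edge Gamma ->
  retraction E (image v) <> 1 ->
  q (image v) = inL _ (retraction E (image v)) ^ g ->
  q (image w) = inL _ (retraction E (image w)) ^ g.
Proof.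
move=> /image_edge[n n_gt0 vwn] vE qv; rewrite -[in RHS]projL_retraction.
apply: (dihedral_inL _ _ _ vE _ n_gt0) => //; try exact: coxeter_ab_sqr.
- exact: abelianization_comm.
- exact: q_image_sqr.
- by rewrite -qv -gmulfM -homX vwn hom1.
Qed.

Lemma q_image_edgeR v w g : [set v; w] \in edge Gamma ->
  retraction F (image v) <> 1 ->
  q (image v) = inR _ (retraction F (image v)) ^ g ->
  q (image w) = inR _ (retraction F (image w)) ^ g.
Proof.
move=> /image_edge[n n_gt0 vwn] vE qv; rewrite -[in RHS]projR_retraction.
apply: (dihedral_inR _ _ _ vE _ n_gt0) => //; try exact: coxeter_ab_sqr.
- exact: abelianization_comm.
- exact: q_image_sqr.
- by rewrite -qv -gmulfM -homX vwn hom1.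
Qed.

End Pair.

(** An involution of the free product attached to [E] and [F] is conjugate into one factor, so one
    of its projections is trivial. *)
Lemma retraction_image_unique (E F : component Gamma) v :
  retraction E (image v) <> 1 -> retraction F (image v) <> 1 -> E = F.
Proof.
move=> vE vF; apply: contrapT => /retraction_pair_exists[q qE].
by case: (q_image_cases qE v) => -[].
Qed.

(** If [w] reached another component [F], its image in the free product attached to [E] and [F]
    would still lie in the same conjugate of the first factor as that of [v], and have trivial
    projection to the second. *)
Lemma retraction_image_edge (E : component Gamma) v w : [set v; w] \in edge Gamma ->
  retraction E (image v) <> 1 -> retraction E (image w) <> 1.
Proof.
move=> vw vE; have [F wF] := retraction_image_exists w.
have [->//|/eqP EF] := eqVneq E F.
have [q qE] := retraction_pair_exists EF.
have [[_ [g vg]]|[]//] := q_image_cases qE v.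
have := q_image_edgeL qE vw vE vg.
move=> /(congr1 (projR _ _)); rewrite (projR_retraction qE) homJ projR_inL conj1g.
by move=> /wF.
Qed.

Lemma retraction_image_connect (E : component Gamma) v w :
  connect (@adjacent Gamma) v w ->
  retraction E (image v) <> 1 -> retraction E (image w) <> 1.
Proof.
move=> /connectP[p + ->]; elim: p v => //= u p IHp v /andP[vu up] vE.
exact/(IHp _ up)/(retraction_image_edge vu).
Qed.

Lemma retraction_image_surj (E : component Gamma) : exists v, retraction E (image v) <> 1.
Proof.
apply: contrapT => /forallNP nE.
have [u uE] := component_neq0 E; apply: (ab_vertex_neq1 uE).
have [x xu] := aut_hom_surj (coxeter_gen u).
rewrite -retraction_gen -xu; elim/coxeter_ind: x {xu} => [|x y xE yE|v].
- by rewrite !hom1.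
- by rewrite !gmulfM xE yE mulg1.
- by apply: contrapT; apply: nE.
Qed.

(* Since the vertices of one component are sent to one factor and every factor
   is reached, counting shows that distinct components go to distinct factors. *)
Lemma retraction_image_inj (E : component Gamma) v w :
  retraction E (image v) <> 1 -> retraction E (image w) <> 1 ->
  connect (@adjacent Gamma) v w.
Proof.
have [u uP] := choice retraction_image_surj.
have [K KP] := choice (@component_of Gamma).
(* [K \o u] assigns to a component one that [f] sends to it. Being an injective self-map of a finite
   type, it is bijective. *)
have KuI : injective (K \o u).
  move=> F F' /= KFF'; apply: (@retraction_image_unique _ _ (u F')); last exact: uP.
  apply: (@retraction_image_connect _ (u F)) (uP F).
  by rewrite -(component_connect _ (KP (u F))) KFF'.
have uK v' E' : retraction E' (image v') <> 1 -> K (u E') = K v'.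
  move=> vE'; have [s _ sK] := injF_bij KuI; have := sK (K v') => /= KusE.
  suff -> : E' = s (K v') by [].
  apply: (@retraction_image_unique _ _ v') => //.
  apply: (@retraction_image_connect _ (u (s (K v')))) (uP _).
  by rewrite -(component_connect _ (KP _)) KusE.
move=> /uK vE /uK wE.
by rewrite -(component_connect _ (KP v)) -vE wE.
Qed.

End ComponentPermutation.

(** * The finite index subgroup *)

Lemma finite_range (S T : Type) (I : finType) (L : S -> T) (d : S -> I) :
  (forall x y, d x = d y -> L x = L y) -> finite_set (range L).
Proof.
(* The element [x0] provides a default value at the indices that [d] does not attain. *)
move=> dL; have [[x0]|nS] := pselect (inhabited S); last first.
  rewrite (_ : range L = set0) //; apply/seteqP; split=> // t [x _ _].
  by case: nS; split.
have /choice[r rP] : forall i, exists y, forall x, d x = i -> L x = y.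
  move=> i; have [[x <-]|nx] := pselect (exists x, d x = i).
    by exists (L x) => x' /dL.
  by exists (L x0) => x xi; case: nx; exists x.
apply: (@sub_finite_set _ _ (range r)); last exact/finite_image/finite_finset.
by move=> _ [x _ <-]; exists (d x) => //; rewrite (rP _ x erefl).
Qed.

Section FiniteIndex.
Variable Gamma : coxeter_graph.
Local Notation W := (coxeter_group Gamma).
Local Notation A E := (abelianization (coxeter_group (induced E))).
Variables (E F : component Gamma).
Hypothesis EF : E <> F.
Local Notation P := (free_product (A (val E)) (A (val F))).
Variable q : {multiplicative W -> P}.
Hypothesis qE : forall v,
  q (coxeter_gen v) = inL _ (ab_vertex (val E) v) * inR _ (ab_vertex (val F) v).

Lemma projection_surj p : exists x, q x = p.
Proof.
have qM x y p1 p2 : q x = p1 -> q y = p2 -> exists z, q z = p1 * p2.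
  by move=> <- <-; exists (x * y); rewrite gmulfM.
have [s _ <-] := eval_surj p; elim: s => [|x s [y yE]].
  by exists 1; rewrite hom1 eval_nil.
suff [z zE] : exists z, q z = syllable x by rewrite eval_cons; apply: (qM _ _ _ _ zE yE).
case: x => a; have [x <-] := to_ab_surj a.
- elim/coxeter_ind: x => [|x x' [z zE] [z' z'E]|u].
  + by exists 1; rewrite !hom1; apply/esym/(hom1 (@inL _ _)).
  + have [t tE] := qM _ _ _ _ zE z'E; exists t.
    by rewrite tE gmulfM; apply/esym/inLM.
  + exists (coxeter_gen (val u)); rewrite qE ab_vertex_in ab_vertex_out ?hom1 ?mulg1 //.
    by apply/negP => uF; apply/EF/(component_inj (valP u) uF).
- elim/coxeter_ind: x => [|x x' [z zE] [z' z'E]|u].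
  + by exists 1; rewrite !hom1; apply/esym/(hom1 (@inR _ _)).
  + have [t tE] := qM _ _ _ _ zE z'E; exists t.
    by rewrite tE gmulfM; apply/esym/inRM.
  + exists (coxeter_gen (val u)).
    rewrite qE ab_vertex_in (@ab_vertex_out _ (val E)) ?hom1 ?mul1g //.
    by apply/negP => uE; apply/EF/(component_inj uE (valP u)).
Qed.

(** The vertices reaching [E] lie in a single component, by [retraction_image_inj], and the
    conjugator found at one of them propagates along edges; the same holds for [F]. Vertices
    reaching neither go to 1. *)
Lemma image_conj_pair (f : automorphism W) : exists g h, forall v,
  q (aut_hom f (coxeter_gen v)) = inL _ (retraction E (aut_hom f (coxeter_gen v))) ^ g
    * inR _ (retraction F (aut_hom f (coxeter_gen v))) ^ h.
Proof.
have [v0 v0E] := retraction_image_surj f E.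
have [w0 w0F] := retraction_image_surj f F.
have [[_ [g v0g]]|[]//] := q_image_cases f qE v0.
have [[] //|[_ [h w0h]]] := q_image_cases f qE w0.
exists g, h => v; have [[vF [k vk]]|[vE [k vk]]] := q_image_cases f qE v.
  rewrite vF hom1 conj1g mulg1.
  have [vE|/eqP vE] := eqVneq (retraction E (aut_hom f (coxeter_gen v))) 1.
    by rewrite vk vE hom1 !conj1g.
  have /connectP[p + ->] := retraction_image_inj v0E vE.
  elim: p v0 v0E v0g => //= u p IHp v' v'E v'g /andP[v'u up].
  apply: (IHp u) => //; first exact: retraction_image_edge v'u v'E.
  exact: (q_image_edgeL qE v'u v'E).
rewrite vE hom1 conj1g mul1g.
have [vF|/eqP vF] := eqVneq (retraction F (aut_hom f (coxeter_gen v))) 1.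
  by rewrite vk vF hom1 !conj1g.
have /connectP[p + ->] := retraction_image_inj w0F vF.
elim: p w0 w0F w0h => //= u p IHp v' v'F v'h /andP[v'u up].
apply: (IHp u) => //; first exact: retraction_image_edge v'u v'F.
exact: (q_image_edgeR qE v'u v'F).
Qed.

Lemma conjg_morph (g : P) : {morph (fun x => x ^ g) : x y / x * y}.
Proof. by move=> x y; apply: conjMg. Qed.

(* Up to conjugation, [q \o f] is determined by its abelianization. *)
Lemma image_conj (f : automorphism W) : exists g, forall v,
  q (aut_hom f (coxeter_gen v)) = (inL _ (retraction E (aut_hom f (coxeter_gen v)))
    * inR _ (retraction F (aut_hom f (coxeter_gen v)))) ^ g.
Proof.
have [g [h fE]] := image_conj_pair f.
(* Conjugated by [g^-1], the map [q \o f] takes its values in the range of [phi], so surjectivity of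
   [q] and [f] passes to [phi]. *)
pose p := h * g^-1.
pose phi : {multiplicative P -> P} :=
  free_lift (@inL _ _) (hom_of (conjg_morph p) \o @inR _ _).
have phiL a : phi (inL _ a) = inL _ a by apply: free_lift_inL.
have phiR b : phi (inR _ b) = inR _ b ^ p by apply: free_lift_inR.
have phi_surj z : exists y, phi y = z.
  have [x xz] := projection_surj (z ^ g).
  have [x' x'x] := aut_hom_surj f x.
  suff [y yE] : exists y, phi y = q (aut_hom f x') ^ g^-1.
    by exists y; rewrite yE x'x xz conjgK.
  elim/coxeter_ind: x' {x'x} => [|y y' [t tE] [t' t'E]|v].
  - by exists 1; rewrite !hom1 conj1g.
  - by exists (t * t'); rewrite !gmulfM tE t'E conjMg.
  exists (inL _ (retraction E (aut_hom f (coxeter_gen v)))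
    * inR _ (retraction F (aut_hom f (coxeter_gen v)))).
  by rewrite gmulfM phiL phiR fE conjMg -!conjgM mulgV conjg1.
have [w wF] := component_neq0 F.
have [b [a pE]] := conj_factor_surj (@coxeter_ab_sqr _) (@coxeter_ab_sqr _)
  (ab_vertex_neq1 wF) phiL phiR phi_surj.
(* One conjugator serves both factors: [inL _ a] commutes with the left factor, and
   [h = inR _ b * (inL _ a * g)], where [inR _ b] commutes with the right one. *)
exists (inL _ a * g) => v; rewrite fE conjMg; congr (_ * _).
  rewrite conjgM; congr (_ ^ _); rewrite -homJ; congr (inL _ _).
  by apply/esym/conjg_fixP/commgP/abelianization_comm.
have -> : h = inR _ b * (inL _ a * g) by rewrite mulgA -pE /p mulgVK.
rewrite conjgM; congr (_ ^ _); rewrite -homJ; congr (inR _ _).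
by apply/conjg_fixP/commgP/abelianization_comm.
Qed.

(** These are the automorphisms that preserve the kernel of [q] and induce an inner automorphism of
    [P]. *)
Definition inner_mod : {pred automorphism W} :=
  fun f : automorphism W => `[< exists p, forall x, q (f x) = q x ^ p >].

Lemma inner_modP (f : automorphism W) :
  reflect (exists p, forall x, q (f x) = q x ^ p) (f \in inner_mod).
Proof. exact: asboolP. Qed.

Fact inner_mod1 : 1 \in inner_mod.
Proof. by apply/inner_modP; exists 1 => x; rewrite conjg1. Qed.

Fact inner_modM : {in inner_mod &, forall f g, f * g \in inner_mod}.
Proof.
move=> f g /inner_modP[p fp] /inner_modP[r gr]; apply/inner_modP; exists (r * p) => x.
by rewrite -[(f * g) x]/(f (g x)) fp gr conjgM.
Qed.

Fact inner_modV : {in inner_mod, forall f, f^-1 \in inner_mod}.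
Proof.
move=> f /inner_modP[p fp]; apply/inner_modP; exists p^-1 => x.
by rewrite -{2}[x](aut_invK f).2 fp conjgK.
Qed.

HB.instance Definition _ := isMulClosed.Build (automorphism W) inner_mod inner_modM.
HB.instance Definition _ := isMul1Closed.Build (automorphism W) inner_mod inner_mod1.
HB.instance Definition _ := isInvClosed.Build (automorphism W) inner_mod inner_modV.

(** Left cosets compare through [f^-1 * g], hence the inverses: by [image_conj], [q \o f^-1] and
    [q \o g^-1] are conjugates of one and the same map. *)
Lemma left_coset_eq (f g : automorphism W) :
  (forall v, retraction E (f^-1 (coxeter_gen v)) = retraction E (g^-1 (coxeter_gen v))) ->
  (forall v, retraction F (f^-1 (coxeter_gen v)) = retraction F (g^-1 (coxeter_gen v))) ->
  left_coset inner_mod f = left_coset inner_mod g.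
Proof.
move=> rE rF; have fg : f^-1 * g \in inner_mod.
  have [k kP] := image_conj f^-1; have [l lP] := image_conj g^-1.
  have klE z : q (aut_hom f^-1 z) = q (aut_hom g^-1 z) ^ (l^-1 * k).
    elim/coxeter_ind: z => [|y z yE zE|v].
    - by rewrite !hom1 conj1g.
    - by rewrite !gmulfM yE zE conjMg.
    - by rewrite kP lP rE rF conjgM conjgK.
  apply/inner_modP; exists (l^-1 * k) => x.
  rewrite -[(f^-1 * g) x]/(aut_hom f^-1 (g x)) klE; congr (q _ ^ _).
  exact: (aut_invK g).1.
have fgE h : (f^-1 * h \in inner_mod) = (g^-1 * h \in inner_mod).
  by rewrite -(gpredMl (g^-1 * h) fg) -mulgA mulVKg.
by apply/funext => h; apply: (congr1 is_true (fgE h)).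
Qed.

Lemma inner_mod_finite_index : finite_index inner_mod.
Proof.
have [k [fE /bij_inj fE_inj]] := coxeter_ab_iso (induced (val E)).
have [l [fF /bij_inj fF_inj]] := coxeter_ab_iso (induced (val F)).
(* The abelianized values are transported to powers of ['Z_2] so that [d] lands in a finite type. *)
pose d (f : automorphism W) :
    {ffun vertex Gamma -> {ffun 'I_k -> 'Z_2} * {ffun 'I_l -> 'Z_2}} :=
  [ffun v => (fE (retraction E (f^-1 (coxeter_gen v))),
    fF (retraction F (f^-1 (coxeter_gen v))))].
apply: (finite_range (d := d)) => f g /ffunP fg; apply: left_coset_eq => v.
  by have := fg v; rewrite !ffunE => -[/fE_inj].
by have := fg v; rewrite !ffunE => -[_ /fF_inj].
Qed.

(** As [q] is onto, [p * p'^-1] is central, and [P] is centerless. *)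
Lemma conj_uniq (p p' : P) : (forall x, q x ^ p = q x ^ p') -> p = p'.
Proof.
move=> pp'; have [v vE] := component_neq0 E; have [w wF] := component_neq0 F.
apply/divg1_eq/(free_product_centerless (ab_vertex_neq1 vE) (ab_vertex_neq1 wF)) => y.
apply/esym/commgP/conjg_fixP; have [x <-] := projection_surj y.
by rewrite conjgM pp' conjgK.
Qed.

Lemma virtually_surjects_free_product : virtually_surjects (automorphism W) P.
Proof.
have fP (f : subgroup inner_mod) : {p | forall x, q (val f x) = q x ^ p}.
  by apply/cid/inner_modP/valP.
(* Conjugation acts on the right, so the conjugating element depends antimultiplicatively on [f];
   the inverse turns this into a homomorphism. *)
pose c f := (projT1 (fP f))^-1.
have cM : {morph c : f g / f * g}.
  move=> f g; rewrite /c -invgM; congr (_^-1); apply: conj_uniq => x.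
  rewrite -(projT2 (fP (f * g)) x) conjgM -(projT2 (fP g) x) -(projT2 (fP f)).
  by [].
exists (inner_mod : groupClosed (automorphism W)), (hom_of cM).
split; first exact: inner_mod_finite_index.
move=> p; have [y yp] := projection_surj p.
(* The inner automorphism [inn y] has conjugating element [p^-1], so [c] sends it to [p]. *)
pose inn (z : W) x := x ^ z^-1.
have innP z : is_automorphism (inn z).
  split; first by move=> a b; apply: conjMg.
  by exists (inn z^-1) => x; rewrite /inn ?invgK -conjgM ?mulgV ?mulVg conjg1.
have innH : Automorphism (innP y) \in inner_mod.
  by apply/inner_modP; exists p^-1 => x; rewrite /= /inn homJ homV yp.
exists (Subgroup innH); rewrite /= /c; apply: invg_inj; rewrite invgK.
apply: conj_uniq => x; rewrite -(projT2 (fP _)) /= /inn.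
by rewrite homJ homV yp.
Qed.

End FiniteIndex.

Theorem theorem1p6 (Gamma : coxeter_graph) (n_ge2 : 2 <= #|components Gamma|)
    (C D : {set vertex Gamma}) (HC : C \in components Gamma)
    (HD : D \in components Gamma) (CD : C <> D) :
  let A := abelianization (coxeter_group (induced C)) in
  let B := abelianization (coxeter_group (induced D)) in
  virtually_surjects (automorphism (coxeter_group Gamma)) (free_product A B) /\
  exists k l : nat,
    [/\ 1 <= k, 1 <= l, isomorphic A (Z2_power k), isomorphic B (Z2_power l)
      & isomorphic (free_product A B)
          (free_product (Z2_power k) (Z2_power l))].
Proof.
move=> A B.
pose E : component Gamma := exist (fun E => E \in components Gamma) C HC.
pose F : component Gamma := exist (fun E => E \in components Gamma) D HD.
have EF : E <> F by move=> /(congr1 val).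
split.
  have [q qE] := retraction_pair_exists EF.
  exact: (virtually_surjects_free_product EF qE).
have [k kA] := coxeter_ab_iso (induced C); have [l lB] := coxeter_ab_iso (induced D).
have [v vC] := component_neq0 E; have [w wD] := component_neq0 F.
exists k, l; split=> //; last exact: isomorphic_free_product.
- exact: Z2_power_gt0 (ab_vertex_neq1 vC) kA.
- exact: Z2_power_gt0 (ab_vertex_neq1 wD) lB.
Qed.
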